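(* Let $R$ be an arbitrary ring. The functor $D_L=L_0(Y\circ\mathrm{ev}_R^{\mathrm{op}}):(\mathrm{mod}\text{-}R,\mathrm{Ab})^{\mathrm{op}}\to\mathrm{fp}(R\text{-}\mathrm{Mod},\mathrm{Ab})$ is fully faithful.
   Context: All categories and functors are additive. $R\text{-}\mathrm{Mod}$ is the category of left $R$-modules and $\mathrm{mod}\text{-}R$ is the category of finitely presented right $R$-modules. $(X,-)$ denotes the representable (Hom) functor; $\otimes=\otimes_R$. $\mathrm{fp}(R\text{-}\mathrm{Mod},\mathrm{Ab})$ is the (abelian) category of finitely presented functors, i.e. additive functors $F:R\text{-}\mathrm{Mod}\to\mathrm{Ab}$ for which there is an exact sequence $(Y,-)\to(X,-)\to F\to0$ with $X,Y\in R\text{-}\mathrm{Mod}$. $(\mathrm{mod}\text{-}R,\mathrm{Ab})$ is the (abelian) category of all additive functors $\mathrm{mod}\text{-}R\to\mathrm{Ab}$. The functor $D_L$ is the $0$-th left derived functor of $Y\circ\mathrm{ev}_R^{\mathrm{op}}:(\mathrm{mod}\text{-}R,\mathrm{Ab})^{\mathrm{op}}\to\mathrm{fp}(R\text{-}\mathrm{Mod},\mathrm{Ab})$, where $\mathrm{ev}_R:(\mathrm{mod}\text{-}R,\mathrm{Ab})\to R\text{-}\mathrm{Mod}$, $F\mapsto F(R_R)$, is evaluation at the ring and $Y:(R\text{-}\mathrm{Mod})^{\mathrm{op}}\to\mathrm{fp}(R\text{-}\mathrm{Mod},\mathrm{Ab})$, $X\mapsto(X,-)$, is the Yoneda embedding.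 The injective objects of $(\mathrm{mod}\text{-}R,\mathrm{Ab})$ are, up to isomorphism, the functors $-\otimes U$ with $U$ a pure-injective left $R$-module (Gruson-Jensen), so $D_L$ is the unique right exact functor agreeing with $-\otimes U\mapsto(U,-)$ on injectives: if $0\to G\to-\otimes U\to-\otimes V$ is exact with $U,V$ pure-injective, then $D_LG$ is the cokernel of the induced map $(V,-)\to(U,-)$. *)

(* Defs.v *)
From HB Require Import structures.
From mathcomp Require Import all_boot all_order all_algebra.
From mathcomp Require Import boolp classical_sets.

Set Implicit Arguments.
Unset Strict Implicit.
Unset Printing Implicit Defensive.

Import Order.TTheory GRing.Theory Num.Theory.
Local Open Scope ring_scope.

(* Preadditive categories.  The abelian group structure on the hom-sets is
   spelled out instead of using zmodType because the hom-sets of the functor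
   categories below are too large for the universe of zmodType. *)
Record category := Category {
  obj :> Type;
  hom : obj -> obj -> Type;
  idm : forall A, hom A A;
  compm : forall A B C, hom B C -> hom A B -> hom A C;
  zerom : forall A B, hom A B;
  oppm : forall A B, hom A B -> hom A B;
  addm : forall A B, hom A B -> hom A B -> hom A B;
  compmA : forall A B C D (h : hom C D) (g : hom B C) (f : hom A B),
    compm h (compm g f) = compm (compm h g) f;
  comp1m : forall A B (f : hom A B), compm (idm B) f = f;
  compm1 : forall A B (f : hom A B), compm f (idm A) = f;
  addmA : forall A B (f g h : hom A B), addm f (addm g h) = addm (addm f g) h;
  addmC : forall A B (f g : hom A B), addm f g = addm g f;
  add0m : forall A B (f : hom A B), addm (zerom A B) f = f;
  addNm : forall A B (f : hom A B), addm (oppm f) f = zerom A B;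
  compmDl : forall A B C (g g' : hom B C) (f : hom A B),
    compm (addm g g') f = addm (compm g f) (compm g' f);
  compmDr : forall A B C (g : hom B C) (f f' : hom A B),
    compm g (addm f f') = addm (compm g f) (compm g f') }.

Arguments idm {c} A.
Arguments zerom {c A B}.

Notation "g \oc f" := (compm g f) (at level 50, left associativity).

Section PreadditiveTheory.
Variable C : category.
Implicit Types A B D : C.

Lemma addm0 A B (f : hom A B) : addm f zerom = f.
Proof. by rewrite addmC add0m. Qed.

Lemma addm_idem0 A B (f : hom A B) : addm f f = f -> f = zerom.
Proof.
by move=> e; rewrite -(add0m f) -(addNm f) -addmA e addNm.
Qed.

Lemma compm0 A B D (g : hom B D) : g \oc zerom = zerom :> hom A D.
Proof. by apply: addm_idem0; rewrite -compmDr add0m. Qed.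

Lemma comp0m A B D (f : hom A B) : zerom \oc f = zerom :> hom A D.
Proof. by apply: addm_idem0; rewrite -compmDl add0m. Qed.

Lemma addm_opp0 A B (f g : hom A B) : addm f (oppm g) = zerom -> f = g.
Proof. by move=> e; rewrite -(addm0 f) -(addNm g) addmA e add0m. Qed.

Lemma compmN A B D (g : hom B D) (f : hom A B) :
  g \oc oppm f = oppm (g \oc f).
Proof.
rewrite -[RHS]add0m -(compm0 A g) -(addNm f) compmDr -addmA.
by rewrite (addmC (g \oc f)) addNm addm0.
Qed.

Lemma compNm A B D (g : hom B D) (f : hom A B) :
  oppm g \oc f = oppm (g \oc f).
Proof.
rewrite -[RHS]add0m -(comp0m D f) -(addNm g) compmDl -addmA.
by rewrite (addmC (g \oc f)) addNm addm0.
Qed.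

Definition epi A B (f : hom A B) : Prop :=
  forall D (g h : hom B D), g \oc f = h \oc f -> g = h.

Definition is_kernel A B K (f : hom A B) (k : hom K A) : Prop :=
  f \oc k = zerom /\
  forall D (g : hom D A), f \oc g = zerom -> exists! u : hom D K, k \oc u = g.

Definition is_cokernel A B Q (f : hom A B) (q : hom B Q) : Prop :=
  q \oc f = zerom /\
  forall D (g : hom B D), g \oc f = zerom -> exists! u : hom Q D, u \oc q = g.

(* exactness of A -> B -> D at B: f maps onto the kernel of g *)
Definition exact A B D (f : hom A B) (g : hom B D) : Prop :=
  exists K (k : hom K B) (p : hom A K), [/\ is_kernel g k, epi p & f = k \oc p].

Definition projective P : Prop :=
  forall A B (e : hom A B), epi e ->
  forall f : hom P B, exists g : hom P A, e \oc g = f.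

(* The initial segment P1 -> P0 -> A -> 0 of a projective resolution of A. *)
Record presentation A := Presentation {
  pr1 : C;
  pr0 : C;
  prd : hom pr1 pr0;
  pre : hom pr0 A;
  pr1_projective : projective pr1;
  pr0_projective : projective pr0;
  prd_exact : exact prd pre;
  pre_epi : epi pre }.

Record cokernel A B (f : hom A B) := Cokernel {
  coker :> C;
  cokerq : hom B coker;
  cokerP : is_cokernel f cokerq }.

End PreadditiveTheory.

Arguments pr1_projective {C A} _ : rename.
Arguments pr0_projective {C A} _ : rename.
Arguments pre_epi {C A} _ : rename.

Record functor (C D : category) := Functor {
  fobj :> C -> D;
  fmap : forall A B : C, hom A B -> hom (fobj A) (fobj B);
  fmap1 : forall A : C, fmap (idm A) = idm (fobj A);
  fmapM : forall (A B E : C) (g : hom B E) (f : hom A B),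
    fmap (g \oc f) = fmap g \oc fmap f;
  fmapD : forall (A B : C) (f g : hom A B),
    fmap (addm f g) = addm (fmap f) (fmap g) }.

Arguments fmap {C D} _ {A B}.

Definition fully_faithful (C D : category) (F : functor C D) : Prop :=
  forall A B : C, bijective (fun f : hom A B => fmap F f).

Lemma fmap0 (C D : category) (F : functor C D) (A B : C) :
  fmap F (@zerom C A B) = zerom.
Proof. by apply: addm_idem0; rewrite -fmapD add0m. Qed.

(* The opposite of (mod-R, Ab) is used below: its epimorphisms are the
   monomorphisms, and its projectives the injectives, of (mod-R, Ab). *)
Program Definition op (C : category) : category :=
  @Category C (fun A B => hom B A) (fun A => idm A)
    (fun A B D g f => f \oc g) (fun A B => zerom)
    (fun A B f => oppm f) (fun A B f g => addm f g)
    _ _ _ _ _ _ _ _ _.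
Next Obligation. by rewrite compmA. Qed.
Next Obligation. exact: compm1. Qed.
Next Obligation. exact: comp1m. Qed.
Next Obligation. exact: addmA. Qed.
Next Obligation. exact: addmC. Qed.
Next Obligation. exact: add0m. Qed.
Next Obligation. exact: addNm. Qed.
Next Obligation. exact: compmDr. Qed.
Next Obligation. exact: compmDl. Qed.

Program Definition fullsub (C : category) (P : C -> Prop) : category :=
  @Category {A : C | P A} (fun A B => hom (sval A) (sval B))
    (fun A => idm (sval A)) (fun A B D g f => g \oc f) (fun A B => zerom)
    (fun A B f => oppm f) (fun A B f g => addm f g)
    _ _ _ _ _ _ _ _ _.
Next Obligation. exact: compmA. Qed.
Next Obligation. exact: comp1m. Qed.
Next Obligation. exact: compm1. Qed.
Next Obligation. exact: addmA. Qed.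
Next Obligation. exact: addmC. Qed.
Next Obligation. exact: add0m. Qed.
Next Obligation. exact: addNm. Qed.
Next Obligation. exact: compmDl. Qed.
Next Obligation. exact: compmDr. Qed.

Program Definition incl (C : category) (P : C -> Prop) :
    functor (fullsub P) C :=
  @Functor (fullsub P) C (fun A => sval A) (fun A B f => f) _ _ _.

Program Definition compf (C D E : category) (G : functor D E)
    (F : functor C D) : functor C E :=
  @Functor C E (fun A => G (F A)) (fun A B f => fmap G (fmap F f)) _ _ _.
Next Obligation. by rewrite !fmap1. Qed.
Next Obligation. by rewrite !fmapM. Qed.
Next Obligation. by rewrite !fmapD. Qed.

Program Definition opf (C D : category) (F : functor C D) :
    functor (op C) (op D) :=
  @Functor (op C) (op D) (fun A => F A) (fun A B f => fmap F f) _ _ _.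
Next Obligation. exact: fmap1. Qed.
Next Obligation. exact: fmapM. Qed.
Next Obligation. exact: fmapD. Qed.

Section FunctorCategory.
Variables C D : category.

Record nat_trans (F G : functor C D) := NatTrans {
  ntc :> forall A : C, hom (F A) (G A);
  ntP : forall (A B : C) (f : hom A B),
    ntc B \oc fmap F f = fmap G f \oc ntc A }.

Lemma nt_eq (F G : functor C D) (s t : nat_trans F G) :
  (forall A, s A = t A) -> s = t.
Proof.
case: s t => [s sP] [t tP] /= e.
have {}e : s = t by apply: functional_extensionality_dep.
by case: _ / e tP => tP; congr NatTrans; apply: Prop_irrelevance.
Qed.

Program Definition nt_id F : nat_trans F F := @NatTrans F F (fun A => idm _) _.
Next Obligation. by rewrite comp1m compm1. Qed.

Program Definition nt_comp F G H (s : nat_trans G H) (t : nat_trans F G) :=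
  @NatTrans F H (fun A => s A \oc t A) _.
Next Obligation. by rewrite -compmA ntP compmA ntP -compmA. Qed.

Program Definition nt_zero F G := @NatTrans F G (fun A => zerom) _.
Next Obligation. by rewrite comp0m compm0. Qed.

Program Definition nt_opp F G (s : nat_trans F G) :=
  @NatTrans F G (fun A => oppm (s A)) _.
Next Obligation. by rewrite compmN compNm ntP. Qed.

Program Definition nt_add F G (s t : nat_trans F G) :=
  @NatTrans F G (fun A => addm (s A) (t A)) _.
Next Obligation. by rewrite compmDl compmDr !ntP. Qed.

Program Definition Fun : category :=
  @Category (functor C D) nat_trans nt_id nt_comp nt_zero nt_opp nt_add
    _ _ _ _ _ _ _ _ _.
Next Obligation. by apply: nt_eq => X /=; rewrite compmA. Qed.
Next Obligation. by apply: nt_eq => X /=; rewrite comp1m. Qed.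
Next Obligation. by apply: nt_eq => X /=; rewrite compm1. Qed.
Next Obligation. by apply: nt_eq => X /=; rewrite addmA. Qed.
Next Obligation. by apply: nt_eq => X /=; rewrite addmC. Qed.
Next Obligation. by apply: nt_eq => X /=; rewrite add0m. Qed.
Next Obligation. by apply: nt_eq => X /=; rewrite addNm. Qed.
Next Obligation. by apply: nt_eq => X /=; rewrite compmDl. Qed.
Next Obligation. by apply: nt_eq => X /=; rewrite compmDr. Qed.

End FunctorCategory.

(* The 0-th left derived functor of F, computed from a choice of projective
   presentations in C and of cokernels in D: L0 A is the cokernel of
   F P1 -> F P0. *)
Section LeftDerived.
Variables C D : category.
Variable pres : forall A : C, presentation A.
Variable cok : forall (X Y : D) (f : hom X Y), cokernel f.
Variable F : functor C D.
Implicit Types A B : C.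

Let P0 A := pr0 (pres A).
Let P1 A := pr1 (pres A).
Let d A : hom (P1 A) (P0 A) := prd (pres A).
Let e A : hom (P0 A) A := pre (pres A).

Definition L0_obj A : D := cok (fmap F (d A)).
Definition L0_pi A : hom (F (P0 A)) (L0_obj A) := cokerq (cok (fmap F (d A))).

(* u : L0 A -> L0 B is induced by some lift a : P0 A -> P0 B of f *)
Definition L0_induced A B (f : hom A B) (u : hom (L0_obj A) (L0_obj B)) : Prop :=
  exists2 a : hom (P0 A) (P0 B), e B \oc a = f \oc e A &
    u \oc L0_pi A = L0_pi B \oc fmap F a.

Lemma L0_pi_epi A : epi (L0_pi A).
Proof.
move=> Z g h gh; have [qf uq] := cokerP (cok (fmap F (d A))).
have [|u [_ uu]] := uq _ (g \oc L0_pi A).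
  by rewrite -compmA qf compm0.
by rewrite -(uu g erefl) -(uu h (esym gh)).
Qed.

Lemma ed0 A : e A \oc d A = zerom.
Proof.
have [K [k [p [[ek _] _ dE]]]] := prd_exact (pres A).
by rewrite [d A]dE compmA [e A \oc k]ek comp0m.
Qed.

Lemma lift_d A (Q : C) (a : hom Q (P0 A)) :
  projective Q -> e A \oc a = zerom -> exists s, a = d A \oc s.
Proof.
move=> prQ ea; have [K [k [p [[_ ku] epip dE]]]] := prd_exact (pres A).
have [u [uE _]] := ku _ a ea; have [s sE] := prQ _ _ p epip u.
by exists s; rewrite [d A]dE -compmA sE uE.
Qed.

Lemma L0_pi_d A : L0_pi A \oc fmap F (d A) = zerom.
Proof. by have [] := cokerP (cok (fmap F (d A))). Qed.

Lemma L0_induced_ex A B (f : hom A B) : exists u, L0_induced f u.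
Proof.
have [a aE] := pr0_projective (pres A) _ _ _ (pre_epi (pres B)) (f \oc e A).
have [|s sE] := @lift_d B (P1 A) (a \oc d A) (pr1_projective (pres A)).
  by rewrite compmA aE -compmA ed0 compm0.
have [_ uq] := cokerP (cok (fmap F (d A))).
have [|u [uE _]] := uq _ (L0_pi B \oc fmap F a).
  by rewrite -compmA -fmapM sE fmapM compmA L0_pi_d comp0m.
by exists u, a.
Qed.

Lemma L0_induced_uniq A B (f : hom A B) u v :
  L0_induced f u -> L0_induced f v -> u = v.
Proof.
case=> a aE uE [b bE vE]; apply: (@L0_pi_epi A); rewrite uE vE.
have [|s sE] := @lift_d B (P0 A) (addm a (oppm b)) (pr0_projective (pres A)).
  by rewrite compmDr compmN aE bE addmC addNm.
have -> : a = addm (d B \oc s) b by rewrite -sE -addmA addNm addm0.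
by rewrite fmapD fmapM compmDr compmA L0_pi_d comp0m add0m.
Qed.

Definition L0_map A B (f : hom A B) : hom (L0_obj A) (L0_obj B) :=
  sval (cid (L0_induced_ex f)).

Lemma L0_mapP A B (f : hom A B) : L0_induced f (L0_map f).
Proof. exact: svalP (cid (L0_induced_ex f)). Qed.

Program Definition L0 : functor C D := @Functor C D L0_obj L0_map _ _ _.
Next Obligation.
apply: L0_induced_uniq (L0_mapP _) _; exists (idm _).
  by rewrite compm1 comp1m.
by rewrite fmap1 compm1 comp1m.
Qed.
Next Obligation.
apply: L0_induced_uniq (L0_mapP _) _.
have [a aE fE] := L0_mapP f; have [b bE gE] := L0_mapP g.
exists (b \oc a); first by rewrite compmA bE -compmA aE compmA.
by rewrite fmapM -compmA fE compmA gE compmA.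
Qed.
Next Obligation.
apply: L0_induced_uniq (L0_mapP _) _.
have [a aE fE] := L0_mapP f; have [b bE gE] := L0_mapP g.
exists (addm a b); first by rewrite compmDr compmDl aE bE.
by rewrite fmapD compmDr compmDl fE gE.
Qed.

End LeftDerived.

Lemma additive_eq (U V : zmodType) (f g : {additive U -> V}) : f =1 g -> f = g.
Proof.
case: f g => [f [[fP]]] [g [[gP]]] /= e.
have {}e : f = g by apply: functional_extensionality_dep.
by case: _ / e gP => gP; rewrite (Prop_irrelevance fP gP).
Qed.

Lemma linear_eq (R : pzRingType) (U V : lmodType R) (f g : {linear U -> V}) :
  f =1 g -> f = g.
Proof.
case: f g => [f [[fP] [fS]]] [g [[gP] [gS]]] /= e.
have {}e : f = g by apply: functional_extensionality_dep.
case: _ / e gP gS => gP gS.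
by rewrite (Prop_irrelevance fP gP) (Prop_irrelevance fS gS).
Qed.

Section Bundle.
Variables (U V : zmodType) (f : U -> V) (fP : zmod_morphism f).
Definition additive_of : {additive U -> V} :=
  HB.pack_for {additive U -> V} f (GRing.isZmodMorphism.Build U V f fP).
End Bundle.

Section BundleLinear.
Variables (R : pzRingType) (U V : lmodType R) (f : U -> V) (fP : linear f).
Definition linear_of : {linear U -> V} :=
  HB.pack_for {linear U -> V} f (GRing.isLinear.Build R U V *:%R f fP).
End BundleLinear.

Section AdditiveZmod.
Variables U V : zmodType.
Implicit Types f g : {additive U -> V}.

Program Definition additive0 : {additive U -> V} := @additive_of U V (fun=> 0) _.
Next Obligation. by move=> x y; rewrite subr0. Qed.

Program Definition additiveN f := @additive_of U V (fun x => - f x) _.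
Next Obligation. by move=> x y; rewrite raddfB opprD. Qed.

Program Definition additiveD f g := @additive_of U V (fun x => f x + g x) _.
Next Obligation. by move=> x y; rewrite !raddfB opprD addrACA. Qed.

Lemma additiveDA : associative additiveD.
Proof. by move=> f g h; apply: additive_eq => x /=; rewrite addrA. Qed.
Lemma additiveDC : commutative additiveD.
Proof. by move=> f g; apply: additive_eq => x /=; rewrite addrC. Qed.
Lemma additive0D : left_id additive0 additiveD.
Proof. by move=> f; apply: additive_eq => x /=; rewrite add0r. Qed.
Lemma additiveND : left_inverse additive0 additiveN additiveD.
Proof. by move=> f; apply: additive_eq => x /=; rewrite addNr. Qed.

HB.instance Definition _ := gen_eqMixin {additive U -> V}.
HB.instance Definition _ := gen_choiceMixin {additive U -> V}.
HB.instance Definition _ := GRing.isZmodule.Build {additive U -> V}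
  additiveDA additiveDC additive0D additiveND.

Lemma additiveDE f g x : (f + g) x = f x + g x.
Proof. by []. Qed.
End AdditiveZmod.

Section LinearZmod.
Variables (R : pzRingType) (U V : lmodType R).
Implicit Types f g : {linear U -> V}.

Program Definition linear0 : {linear U -> V} := @linear_of R U V (fun=> 0) _.
Next Obligation. by move=> a x y; rewrite scaler0 addr0. Qed.

Program Definition linearDN f := @linear_of R U V (fun x => - f x) _.
Next Obligation. by move=> a x y; rewrite linearP opprD scalerN. Qed.

Program Definition linearDD f g := @linear_of R U V (fun x => f x + g x) _.
Next Obligation. by move=> a x y; rewrite !linearP scalerDr addrACA. Qed.

Lemma linearDA : associative linearDD.
Proof. by move=> f g h; apply: linear_eq => x /=; rewrite addrA. Qed.
Lemma linearDC : commutative linearDD.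
Proof. by move=> f g; apply: linear_eq => x /=; rewrite addrC. Qed.
Lemma linear0D : left_id linear0 linearDD.
Proof. by move=> f; apply: linear_eq => x /=; rewrite add0r. Qed.
Lemma linearND : left_inverse linear0 linearDN linearDD.
Proof. by move=> f; apply: linear_eq => x /=; rewrite addNr. Qed.

HB.instance Definition _ := gen_eqMixin {linear U -> V}.
HB.instance Definition _ := gen_choiceMixin {linear U -> V}.
HB.instance Definition _ := GRing.isZmodule.Build {linear U -> V}
  linearDA linearDC linear0D linearND.
End LinearZmod.

Program Definition additive_comp (U V W : zmodType) (g : {additive V -> W})
  (f : {additive U -> V}) := @additive_of U W (fun x => g (f x)) _.
Next Obligation. by move=> x y; rewrite !raddfB. Qed.

Lemma additive_compE (U V W : zmodType) (g : {additive V -> W})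
  (f : {additive U -> V}) x : additive_comp g f x = g (f x).
Proof. by []. Qed.

Program Definition additive_id (U : zmodType) := @additive_of U U id _.
Next Obligation. by []. Qed.

Program Definition linear_comp (R : pzRingType) (U V W : lmodType R)
    (g : {linear V -> W}) (f : {linear U -> V}) :=
  @linear_of R U W (fun x => g (f x)) _.
Next Obligation. by move=> a x y; rewrite !linearP. Qed.

Program Definition linear_id (R : pzRingType) (U : lmodType R) :=
  @linear_of R U U id _.
Next Obligation. by []. Qed.

Program Definition Ab : category :=
  @Category zmodType (fun U V => {additive U -> V}) additive_id additive_comp
    (fun U V => 0) (fun U V f => - f) (fun U V f g => f + g) _ _ _ _ _ _ _ _ _.
Next Obligation. exact: additive_eq. Qed.
Next Obligation. exact: additive_eq. Qed.
Next Obligation. exact: additive_eq. Qed.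
Next Obligation. exact: addrA. Qed.
Next Obligation. exact: addrC. Qed.
Next Obligation. exact: add0r. Qed.
Next Obligation. exact: addNr. Qed.
Next Obligation. exact: additive_eq. Qed.
Next Obligation. by apply: additive_eq => x /=; rewrite raddfD. Qed.

Program Definition Mod (R : pzRingType) : category :=
  @Category (lmodType R) (fun U V => {linear U -> V}) (@linear_id R)
    (@linear_comp R) (fun U V => 0) (fun U V f => - f) (fun U V f g => f + g)
    _ _ _ _ _ _ _ _ _.
Next Obligation. exact: linear_eq. Qed.
Next Obligation. exact: linear_eq. Qed.
Next Obligation. exact: linear_eq. Qed.
Next Obligation. exact: addrA. Qed.
Next Obligation. exact: addrC. Qed.
Next Obligation. exact: add0r. Qed.
Next Obligation. exact: addNr. Qed.
Next Obligation. exact: linear_eq. Qed.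
Next Obligation. by apply: linear_eq => x /=; rewrite raddfD. Qed.

Section Representable.
Variable R : pzRingType.

Program Definition homf_map (X A B : lmodType R) (f : {linear A -> B}) :
    {additive {linear X -> A} -> {linear X -> B}} :=
  additive_of (f := fun h : {linear X -> A} => linear_comp f h) _.
Next Obligation. by move=> g h; apply: linear_eq => x /=; rewrite raddfB. Qed.

(* (X, -) *)
Program Definition homf (X : Mod R) : functor (Mod R) Ab :=
  @Functor (Mod R) Ab (fun A => {linear X -> A} : zmodType)
    (fun A B f => homf_map X f) _ _ _.
Next Obligation. by apply: additive_eq => h; apply: linear_eq. Qed.
Next Obligation. by apply: additive_eq => h; apply: linear_eq. Qed.
Next Obligation. by apply: additive_eq => h; apply: linear_eq. Qed.

Program Definition homf_pre_map (X Y A : lmodType R) (g : {linear X -> Y}) :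
    {additive {linear Y -> A} -> {linear X -> A}} :=
  additive_of (f := fun h : {linear Y -> A} => linear_comp h g) _.
Next Obligation. by move=> h k; apply: linear_eq. Qed.

(* (g, -) *)
Program Definition homf_pre (X Y : Mod R) (g : hom X Y) :
    nat_trans (homf Y) (homf X) :=
  @NatTrans _ Ab (homf Y) (homf X) (fun A => homf_pre_map A g) _.
Next Obligation. by apply: additive_eq => h; apply: linear_eq. Qed.

(* there is an exact sequence (Y, -) -> (X, -) -> F -> 0 *)
Definition fp_functor (F : functor (Mod R) Ab) : Prop :=
  exists (X Y : Mod R) (a : nat_trans (homf Y) (homf X))
         (p : nat_trans (homf X) F),
    forall A : Mod R,
      (forall z : F A, exists x, p A x = z) /\
      (forall x, p A x = 0 <-> exists y, a A y = x).

Definition fpModAb : category := @fullsub (Fun (Mod R) Ab) fp_functor.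

Lemma fp_homf (X : Mod R) : fp_functor (homf X).
Proof.
exists X, X, (nt_zero _ _), (nt_id _) => A; split=> [z|x /=]; first by exists z.
by split=> [->|[y <-]//]; exists 0.
Qed.

Program Definition Yoneda : functor (op (Mod R)) fpModAb :=
  @Functor (op (Mod R)) fpModAb (fun X => exist _ (homf X) (fp_homf X))
    (fun X Y f => homf_pre f) _ _ _.
Next Obligation.
by apply: nt_eq => Z; apply: additive_eq => h; apply: linear_eq.
Qed.
Next Obligation.
by apply: nt_eq => Z; apply: additive_eq => h; apply: linear_eq.
Qed.
Next Obligation.
apply: nt_eq => Z; apply: additive_eq => h; apply: linear_eq => x /=.
by rewrite raddfD.
Qed.

End Representable.

Section AbCokernel.
Variables (U V : zmodType) (f : {additive U -> V}).

Definition im_pred : {pred V} := fun v => `[< exists u, f u = v >].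

Lemma im_pred_zmod : zmod_closed im_pred.
Proof.
split; first by apply/asboolP; exists 0; rewrite raddf0.
by move=> x y /asboolP[u <-] /asboolP[v <-]; apply/asboolP; exists (u - v);
  rewrite raddfB.
Qed.
HB.instance Definition _ := GRing.isZmodClosed.Build V im_pred im_pred_zmod.

Definition ab_coker : zmodType := @Quotient.quot V im_pred.

Lemma ab_cokerq_subproof : zmod_morphism (\pi_(@Quotient.quot V im_pred)%qT : V -> ab_coker).
Proof. by move=> x y; rewrite raddfB. Qed.

Definition ab_cokerq : {additive V -> ab_coker} := additive_of ab_cokerq_subproof.

Lemma ab_cokerq_surj x : exists v, ab_cokerq v = x.
Proof. by exists (repr x); rewrite /= reprK. Qed.

Lemma ab_cokerq_eq0 v : ab_cokerq v = 0 <-> exists u, f u = v.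
Proof.
rewrite -(raddf0 ab_cokerq) /=; split.
  by move/eqP; rewrite -Quotient.idealrBE subr0 => /asboolP.
by move=> h; apply/eqP; rewrite -Quotient.idealrBE subr0; apply/asboolP.
Qed.

Section Lift.
Variables (W : zmodType) (h : {additive V -> W}) (hf : forall u, h (f u) = 0).

Definition ab_lift_fun (x : ab_coker) : W := h (sval (cid (ab_cokerq_surj x))).

Lemma ab_lift_funE v : ab_lift_fun (ab_cokerq v) = h v.
Proof.
rewrite /ab_lift_fun; case: cid => w /= wv.
have /ab_cokerq_eq0[u uE] : ab_cokerq (w - v) = 0 by rewrite raddfB /= wv subrr.
by apply/eqP; rewrite -subr_eq0 -raddfB -uE hf.
Qed.

Lemma ab_lift_zmod : zmod_morphism ab_lift_fun.
Proof.
move=> x y; have [v <-] := ab_cokerq_surj x; have [w <-] := ab_cokerq_surj y.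
by rewrite -raddfB !ab_lift_funE raddfB.
Qed.

Definition ab_lift : {additive ab_coker -> W} := additive_of ab_lift_zmod.

Lemma ab_liftE v : ab_lift (ab_cokerq v) = h v.
Proof. exact: ab_lift_funE. Qed.
End Lift.

End AbCokernel.

Lemma ntE (C : category) (F G : functor C Ab) (s : nat_trans F G) (A B : C)
  (u : hom A B) x : s B (fmap F u x) = fmap G u (s A x).
Proof. by have := ntP s u; move=> /(congr1 (fun h : {additive _ -> _} => h x)). Qed.

Lemma ab_fmap1 (C : category) (F : functor C Ab) (A : C) x :
  fmap F (idm A) x = x.
Proof. by rewrite fmap1. Qed.

Lemma ab_fmapM (C : category) (F : functor C Ab) (A B E : C)
  (g : hom B E) (f : hom A B) x : fmap F (g \oc f) x = fmap F g (fmap F f x).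
Proof. by rewrite fmapM. Qed.

Lemma ab_fmapD (C : category) (F : functor C Ab) (A B : C)
  (f g : hom A B) x : fmap F (addm f g) x = fmap F f x + fmap F g x.
Proof. by rewrite fmapD. Qed.

(* cokernels in a category of additive functors, computed pointwise *)
Section FunCokernel.
Variables (C : category) (F G : functor C Ab) (s : nat_trans F G).

Lemma fcoker_subproof (A B : C) (u : hom A B) (x : F A) :
  additive_comp (ab_cokerq (s B)) (fmap G u) (s A x) = 0.
Proof. by apply/ab_cokerq_eq0; exists (fmap F u x); rewrite ntE. Qed.

Definition fcoker_map (A B : C) (u : hom A B) :
    {additive ab_coker (s A) -> ab_coker (s B)} :=
  ab_lift (@fcoker_subproof A B u).

Lemma fcoker_mapE (A B : C) (u : hom A B) x :
  fcoker_map u (ab_cokerq (s A) x) = ab_cokerq (s B) (fmap G u x).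
Proof. exact: ab_liftE. Qed.

Program Definition fcoker : functor C Ab :=
  @Functor C Ab (fun A => ab_coker (s A)) fcoker_map _ _ _.
Next Obligation.
apply: additive_eq => x; have [v <-] := ab_cokerq_surj x.
by rewrite fcoker_mapE ab_fmap1.
Qed.
Next Obligation.
apply: additive_eq => x; have [v <-] := ab_cokerq_surj x.
by rewrite additive_compE !fcoker_mapE ab_fmapM.
Qed.
Next Obligation.
apply: additive_eq => x; have [v <-] := ab_cokerq_surj x.
by rewrite additiveDE !fcoker_mapE ab_fmapD raddfD.
Qed.

Program Definition fcokerq : nat_trans G fcoker :=
  @NatTrans C Ab G fcoker (fun A => ab_cokerq (s A)) _.
Next Obligation. by apply: additive_eq => x; rewrite [RHS]fcoker_mapE. Qed.

Lemma fcokerq_eq0 (A : C) x : fcokerq A x = 0 <-> exists y, s A y = x.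
Proof. exact: ab_cokerq_eq0. Qed.

Lemma fcokerq_surj (A : C) x : exists y, fcokerq A y = x.
Proof. exact: ab_cokerq_surj. Qed.

Lemma fcokerP : @is_cokernel (Fun C Ab) F G fcoker s fcokerq.
Proof.
split.
  apply: nt_eq => A; apply: additive_eq => x.
  exact: (proj2 (ab_cokerq_eq0 (s A) (s A x)) (ex_intro _ x erefl)).
move=> H g gs.
have gs0 A x : g A (s A x) = 0.
  by have := congr1 (fun t : nat_trans F H => t A x) gs.
have natu : forall (A B : C) (f : hom A B),
    compm (c := Ab) (ab_lift (gs0 B)) (fmap fcoker f) =
    compm (c := Ab) (fmap H f) (ab_lift (gs0 A)).
  move=> A B f; apply: additive_eq => x; have [v <-] := ab_cokerq_surj x.
  transitivity (ab_lift (gs0 B) (fcoker_map f (ab_cokerq (s A) v))) => //.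
  transitivity (fmap H f (ab_lift (gs0 A) (ab_cokerq (s A) v))) => //.
  by rewrite fcoker_mapE !ab_liftE ntE.
exists (@NatTrans C Ab fcoker H (fun A => ab_lift (gs0 A)) natu); split.
  by apply: nt_eq => A; apply: additive_eq => x; apply: ab_liftE.
move=> u' uE; apply: nt_eq => A; apply: additive_eq => x.
have [v <-] := ab_cokerq_surj x.
rewrite [LHS](ab_liftE (gs0 A)).
by have := congr1 (fun t : nat_trans G H => t A v) uE.
Qed.

End FunCokernel.

Section FpCokernel.
Variable R : pzRingType.

Lemma homf_ntE (X : Mod R) (F : functor (Mod R) Ab) (t : nat_trans (homf X) F)
  (A : Mod R) (h : {linear X -> A}) : t A h = fmap F h (t X (linear_id X)).
Proof. by rewrite -(ntE t h); congr (t A _); apply: linear_eq. Qed.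

Definition prod_mod (Y Z : lmodType R) : lmodType R := (Y * Z)%type.

Section Pairing.
Variables (X Y Z A : lmodType R) (c : {linear X -> Y}) (t : {linear X -> Z}).

Program Definition linear_pair : {linear X -> prod_mod Y Z} :=
  @linear_of R X (prod_mod Y Z) (fun x => (c x, t x)) _.
Next Obligation. by move=> a x y; rewrite !linearP. Qed.

Program Definition linear_copair (y : {linear Y -> A}) (z : {linear Z -> A}) :
  {linear prod_mod Y Z -> A} :=
  @linear_of R (prod_mod Y Z) A (fun p => y p.1 + z p.2) _.
Next Obligation. by move=> a p q /=; rewrite !linearP scalerDr addrACA. Qed.

Program Definition linear_inl : {linear Y -> prod_mod Y Z} :=
  @linear_of R Y (prod_mod Y Z) (fun y => (y, 0)) _.
Next Obligation. by move=> a p q; congr pair; rewrite /= ?scaler0 ?addr0. Qed.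

Program Definition linear_inr : {linear Z -> prod_mod Y Z} :=
  @linear_of R Z (prod_mod Y Z) (fun z => (0, z)) _.
Next Obligation. by move=> a p q; congr pair; rewrite /= ?scaler0 ?addr0. Qed.
End Pairing.

Lemma fp_fcoker (F G : functor (Mod R) Ab) (f : nat_trans F G) :
  fp_functor F -> fp_functor G -> fp_functor (fcoker f).
Proof.
move=> [X [Y0 [a0 [p pP]]]] [X' [Y' [a [q qP]]]].
have [t tE] := (qP X).1 (f X (p X (linear_id X))).
pose c : {linear X' -> Y'} := a Y' (linear_id Y').
exists X', (prod_mod Y' X), (homf_pre (linear_pair c t)).
exists (nt_comp (fcokerq f) q) => A; split=> [z|x].
  have [y <-] := fcokerq_surj z; have [w <-] := (qP A).1 y.
  by exists w.
have aE (y : {linear Y' -> A}) : a A y = linear_comp y c by rewrite homf_ntE.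
have tA (u : {linear X -> A}) : q A (linear_comp u t) = f A (p A u).
  rewrite (homf_ntE p u) (ntE f (A := X : Mod R)) -tE.
  by rewrite -(ntE q (A := X : Mod R)).
have qE : (nt_comp (fcokerq f) q) A x = fcokerq f A (q A x) by [].
rewrite qE; split=> [/fcokerq_eq0[w wE]|[h <-]].
  have [u uE] := (pP A).1 w.
  have /(qP A).2[y yE] : q A (x - linear_comp u t) = 0.
    by rewrite raddfB tA uE wE subrr.
  exists (linear_copair y u); apply: linear_eq => v /=.
  have := congr1 (fun h : {linear _ -> _} => h v) yE; rewrite aE /= => ->.
  by rewrite subrK.
have -> : homf_pre (linear_pair c t) A h =
    linear_comp (linear_comp h (linear_inl _ _)) c +
    linear_comp (linear_comp h (linear_inr _ _)) t.
  apply: linear_eq => v /=; rewrite -raddfD; congr (h _).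
  by congr pair; rewrite /= (addr0, add0r).
apply/fcokerq_eq0; exists (p A (linear_comp h (linear_inr _ _))).
rewrite raddfD tA -aE (_ : q A (a A _) = 0) ?add0r //.
by apply/(qP A).2; exists (linear_comp h (linear_inl _ _)).
Qed.

Definition fp_cokernel (F G : fpModAb R) (f : hom F G) : cokernel f.
Proof.
pose Q : fpModAb R := exist _ (fcoker f) (fp_fcoker f (svalP F) (svalP G)).
exists Q (fcokerq f); have [qf uq] := fcokerP f; split=> // H g gf.
exact: (uq (sval H) g gf).
Defined.

End FpCokernel.

Section QZ.

Program Definition int_to_rat : {additive int -> rat} :=
  @additive_of int rat (fun k => k%:~R) _.
Next Obligation. by move=> x y; rewrite rmorphB. Qed.

Definition QZ : zmodType := ab_coker int_to_rat.

Lemma QZ_div (d : QZ) n : (0 < n)%N -> exists e, e *+ n = d.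
Proof.
move=> n0; have [q <-] := ab_cokerq_surj d.
exists (ab_cokerq int_to_rat (q / n%:R)); rewrite -raddfMn -[(q / _) *+ n]mulr_natr.
by rewrite divfK // pnatr_eq0 -lt0n.
Qed.

Lemma QZ_tors n : (1 < n)%N -> exists2 e : QZ, e != 0 & e *+ n = 0.
Proof.
move=> n1; have n0 : n%:R != 0 :> rat by rewrite pnatr_eq0 -lt0n ltnW.
exists (ab_cokerq int_to_rat n%:R^-1).
  apply/eqP => /ab_cokerq_eq0[k /= kE].
  have : (k * n%:Z)%:~R = 1 :> rat by rewrite rmorphM /= kE mulVf.
  move=> /eqP; rewrite -[1]/(1%:~R) eqr_int => /eqP/(congr1 absz).
  rewrite abszM /= => /eqP; rewrite muln_eq1 => /andP[_ /eqP nE].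
  by rewrite nE in n1.
rewrite -raddfMn -[_^-1 *+ n]mulr_natr mulVf //; apply/ab_cokerq_eq0.
by exists 1.
Qed.

Section Extend.
Variable A : zmodType.
Implicit Type S : set (A * QZ).

Definition subgroup_graph S : Prop :=
  [/\ S (0, 0), forall x y x' y', S (x, y) -> S (x', y') -> S (x - x', y - y')
    & forall y, S (0, y) -> y = 0].

Section Closure.
Variables (S : set (A * QZ)) (gS : subgroup_graph S).

Lemma sgN x y : S (x, y) -> S (- x, - y).
Proof.
by case: gS => S0 SB _ Sxy; rewrite -[- x]add0r -[- y]add0r; apply: SB.
Qed.

Lemma sgB x y x' y' : S (x, y) -> S (x', y') -> S (x - x', y - y').
Proof. by case: gS => _ SB _; apply: SB. Qed.

Lemma sgD x y x' y' : S (x, y) -> S (x', y') -> S (x + x', y + y').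
Proof.
by move=> Sxy /sgN; rewrite -{2}[x']opprK -{2}[y']opprK; apply: sgB.
Qed.

Lemma sgMn x y n : S (x, y) -> S (x *+ n, y *+ n).
Proof.
move=> Sxy; elim: n => [|n IH]; first by rewrite !mulr0n; case: gS.
by rewrite !mulrS; apply: sgD.
Qed.

Lemma sgMz x y (k : int) : S (x, y) -> S (x *~ k, y *~ k).
Proof. by case: k => n Sxy; [exact: sgMn|apply/sgN/sgMn]. Qed.

Lemma sg_inj x y y' : S (x, y) -> S (x, y') -> y = y'.
Proof.
case: gS => _ _ S0 /sgB h /h; rewrite subrr => /S0/eqP.
by rewrite subr_eq0 => /eqP.
Qed.

Lemma sg_next a : exists d : QZ, forall (k : int) y, S (a *~ k, y) -> y = d *~ k.
Proof.
case: (pselect (exists n, (0 < n)%N && `[< exists y, S (a *+ n, y) >])); last first.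
  move=> no; exists 0 => k y Sk; rewrite mul0rz.
  have [k0|k0] := eqVneq k 0.
    by move: Sk; rewrite k0 mulr0z; case: gS => _ _; apply.
  case: no; exists `|k|%N; rewrite absz_gt0 k0; apply/asboolP.
  case: k Sk {k0} => n Sk; first by exists y.
  by exists (- y); rewrite -[a *+ _]opprK; apply: sgN.
move=> ex; case: (ex_minnP ex) => n /andP[n0 /asboolP[y0 Sn]] nmin.
have [d dE] := QZ_div y0 n0; exists d => k y Sk.
have kE := divz_eq k n.
have Sq := sgMz (k %/ n)%Z Sn.
have aq : a *+ n *~ (k %/ n)%Z = a *~ ((k %/ n)%Z * n) by rewrite mulrC mulrzA.
have yq : y0 *~ (k %/ n)%Z = d *~ ((k %/ n)%Z * n).
  by rewrite -dE mulrC mulrzA.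
have r0 : (k %% n)%Z = 0.
  apply/eqP; apply: contraT => rn0.
  have rge : (0 <= (k %% n)%Z)%R by rewrite modz_ge0 // -lt0n.
  have rlt : ((k %% n)%Z < n)%R by rewrite ltz_pmod.
  have := sgB Sk Sq; rewrite aq -mulrzBr {1}kE addrC addKr.
  move: rge rlt rn0; case: (k %% n)%Z => // r _ rlt rn0 Sr.
  have : (n <= r)%N.
    by apply: nmin; rewrite lt0n rn0; apply/asboolP; eexists; exact: Sr.
  by rewrite leqNgt; move: rlt; rewrite ltz_nat => ->.
move: kE; rewrite r0 addr0 => kE.
by apply: (sg_inj Sk); rewrite kE -aq -yq.
Qed.

End Closure.

Lemma QZ_extend S0 : subgroup_graph S0 ->
  exists g : {additive A -> QZ}, forall x y, S0 (x, y) -> g x = y.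
Proof.
move=> gS0.
pose P S := S = set0 \/ (S0 `<=` S)%classic /\ subgroup_graph S.
have [|S [PS Smax]] := @Zorn_bigcup (A * QZ)%type P.
  move=> F FP tot; have [[X FX X0]|no] := pselect (exists2 X, F X & X != set0); last first.
    left; apply/seteqP; split=> // p [X FX Xp]; case: no; exists X => //.
    by apply/set0P; exists p.
  have XP Z : F Z -> Z != set0 -> (S0 `<=` Z)%classic /\ subgroup_graph Z.
    by move=> FZ Z0; case: (FP Z FZ) => // ZE; rewrite ZE eqxx in Z0.
  right; have [S0X gX] := XP X FX X0; split.
    by move=> p /S0X Xp; exists X.
  split.
  - by exists X => //; case: gX.
  - move=> x y x' y' [Z FZ Zxy] [Z' FZ' Zxy'].
    have [ZZ'|Z'Z] := tot Z Z' FZ FZ'.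
      have [|_ gZ'] := XP Z' FZ'; first by apply/set0P; exists (x', y').
      by exists Z' => //; apply: (sgB gZ') => //; apply: ZZ'.
    have [|_ gZ] := XP Z FZ; first by apply/set0P; exists (x, y).
    by exists Z => //; apply: (sgB gZ) => //; apply: Z'Z.
  - move=> y [Z FZ Zy]; have [|_ [_ _]] := XP Z FZ; last exact.
    by apply/set0P; exists (0, y).
have [S0S gS] : (S0 `<=` S)%classic /\ subgroup_graph S.
  case: PS => // SE; exfalso; apply: (Smax S0); last by right; split.
  by rewrite SE; split=> // S00; case: gS0 => /S00.
have Stot a : exists y, S (a, y).
  apply: contrapT => no; have [d dP] := sg_next gS a.
  pose S' : set (A * QZ) :=
    fun p => exists x y (k : int), S (x, y) /\ p = (x + a *~ k, y + d *~ k).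
  have SS' : (S `<=` S')%classic.
    by move=> [x y] Sxy; exists x, y, 0; rewrite !mulr0z !addr0.
  apply: (Smax S').
    split=> // S'S; apply: no; exists d; apply: S'S; exists 0, 0, 1.
    by rewrite !add0r; split=> //; case: gS.
  right; split; first by move=> p /S0S/SS'.
  split; first by apply: SS'; case: gS.
  - move=> _ _ _ _ [x [y [k [Sxy [-> ->]]]]] [x' [y' [k' [Sxy' [-> ->]]]]].
    exists (x - x'), (y - y'), (k - k'); split; first exact: (sgB gS).
    by rewrite !mulrzBr !opprD !(addrACA _ _ (- _)).
  - move=> _ [x [y [k [Sxy [/esym xk ->]]]]].
    have xE : x = a *~ (- k) by rewrite mulrNz; apply/eqP; rewrite -addr_eq0 xk.
    by rewrite xE in Sxy; rewrite (dP _ _ Sxy) mulrNz addNr.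
pose g a := sval (cid (Stot a)).
have gP a : S (a, g a) := svalP (cid (Stot a)).
have ga : zmod_morphism g.
  by move=> x y; apply: (sg_inj gS (gP _)); apply: (sgB gS).
exists (additive_of ga) => x y /S0S Sxy; exact: (sg_inj gS (gP x) Sxy).
Qed.

Lemma QZ_cogen (x : A) : x != 0 -> exists g : {additive A -> QZ}, g x != 0.
Proof.
move=> x0.
have [d d0 dP] : exists2 d : QZ, d != 0 & forall k : int, x *~ k = 0 -> d *~ k = 0.
  have [ex|no] := pselect (exists n, (0 < n)%N && (x *+ n == 0)); last first.
    have [//|d d0 _] := @QZ_tors 2; exists d => // k xk.
    have [->|k0] := eqVneq k 0; first by rewrite mulr0z.
    case: no; exists `|k|%N; rewrite absz_gt0 k0.
    by case: k xk {k0} => n /eqP //; rewrite NegzE mulrNz oppr_eq0.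
  case: (ex_minnP ex) => n /andP[n0 /eqP xn] nmin.
  have n1 : (1 < n)%N.
    by case: n n0 xn {nmin} => [|[|n]] // _ xE; move: x0; rewrite -[x]mulr1n xE eqxx.
  have [d d0 dn] := QZ_tors n1; exists d => // k xk.
  have kE := divz_eq k n.
  have r0 : (k %% n)%Z = 0.
    apply/eqP; apply: contraT => rn0.
    have rge : (0 <= (k %% n)%Z)%R by rewrite modz_ge0 // -lt0n.
    have rlt : ((k %% n)%Z < n)%R by rewrite ltz_pmod.
    have : x *~ (k %% n)%Z = 0.
      by move: xk; rewrite {1}kE mulrzDr mulrC mulrzA -pmulrn xn mul0rz add0r.
    move: rge rlt rn0; case: (k %% n)%Z => // r _ rlt rn0 /eqP xr.
    have : (n <= r)%N by apply: nmin; rewrite lt0n rn0.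
    by rewrite leqNgt; move: rlt; rewrite ltz_nat => ->.
  by rewrite kE r0 addr0 mulrC mulrzA -pmulrn dn mul0rz.
pose S0 : set (A * QZ) := fun p => exists k : int, p = (x *~ k, d *~ k).
have [|g gP] := @QZ_extend S0.
  split; first by exists 0; rewrite !mulr0z.
  - by move=> _ _ _ _ [k [-> ->]] [k' [-> ->]]; exists (k - k'); rewrite !mulrzBr.
  - by move=> y [k [/esym xk ->]]; apply: dP.
by exists g; rewrite (gP x d) //; exists 1.
Qed.

End Extend.

Lemma QZ_injective (B A : zmodType) (i : {additive B -> A})
    (f : {additive B -> QZ}) : (forall b, i b = 0 -> b = 0) ->
  exists g : {additive A -> QZ}, forall b, g (i b) = f b.
Proof.
move=> i0; pose S0 : set (A * QZ) := fun p => exists b, p = (i b, f b).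
have [|g gP] := @QZ_extend A S0.
  split; first by exists 0; rewrite !raddf0.
  - by move=> _ _ _ _ [b [-> ->]] [b' [-> ->]]; exists (b - b'); rewrite !raddfB.
  - by move=> y [b [/esym/i0-> ->]]; rewrite raddf0.
by exists g => b; apply: gP; exists b.
Qed.

End QZ.

Section ModR.
Variable R : pzRingType.

(* an exact sequence S^m -> S^n -> M -> 0 *)
Definition presented (S : pzRingType) (M : lmodType S) (m n : nat)
    (a : {linear 'rV[S]_m -> 'rV[S]_n}) : Prop :=
  exists p : {linear 'rV[S]_n -> M},
    (forall x, exists v, p v = x) /\
    (forall v, p v = 0 <-> exists w, a w = v).

Definition fp_module (S : pzRingType) (M : Mod S) : Prop :=
  exists m n (a : {linear 'rV[S]_m -> 'rV[S]_n}), presented M a.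

(* Right R-modules are left modules over the converse ring R^c. *)
Definition modR : category := @fullsub (Mod R^c) (@fp_module R^c).

Definition regR : lmodType R^c := (R^c)^o.

Program Definition row1_fst : {linear 'rV[R^c]_1 -> regR} :=
  @linear_of R^c 'rV[R^c]_1 regR (fun v => v 0 0) _.
Next Obligation. by move=> a u v; rewrite !mxE. Qed.

Lemma fp_regR : fp_module (regR : Mod R^c).
Proof.
exists 0%N, 1%N, 0, row1_fst; split=> [x|v].
  by exists (\row_j x) => /=; rewrite mxE.
split=> [v0|[w <-]]; last by rewrite /= mxE.
by exists 0; apply/rowP => j; rewrite ord1 [RHS]v0 mxE.
Qed.

Definition RR : modR := exist _ regR fp_regR.

(* left multiplication by r, as an endomorphism of R_R *)
Program Definition lmulR (r : R) : {linear regR -> regR} :=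
  @linear_of R^c regR regR (fun x : R => r * x) _.
Next Obligation.
by move=> a x y; rewrite mulrDr; congr (_ + _); exact: (@mulrA R r x a).
Qed.

Definition ModRAb : category := Fun modR Ab.

(* F(R_R), a left R-module through the left multiplications of R_R *)
Section EvObj.
Variable F : ModRAb.

Definition ev_obj : Type := (F : functor modR Ab) RR.
HB.instance Definition _ := GRing.Zmodule.on ev_obj.

Definition ev_scale (r : R) (x : ev_obj) : ev_obj :=
  fmap F (lmulR r : hom RR RR) x.

Lemma ev_scaleA r s x : ev_scale r (ev_scale s x) = ev_scale (r * s) x.
Proof.
rewrite /ev_scale -ab_fmapM; congr (fmap F _ x).
by apply: linear_eq => y; exact: (@mulrA R r s y).
Qed.

Lemma ev_scale1 : left_id 1 ev_scale.
Proof.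
move=> x; rewrite -[RHS]ab_fmap1; congr (fmap F _ x).
by apply: linear_eq => y; exact: (@mul1r R y).
Qed.

Lemma ev_scaleDr : right_distributive ev_scale +%R.
Proof. by move=> r x y; rewrite /ev_scale raddfD. Qed.

Lemma ev_scaleDl x : {morph ev_scale^~ x : r s / r + s}.
Proof.
move=> r s; rewrite /ev_scale -ab_fmapD; congr (fmap F _ x).
by apply: linear_eq => y; exact: (@mulrDl R r s y).
Qed.

HB.instance Definition _ := GRing.Zmodule_isLmodule.Build R ev_obj
  ev_scaleA ev_scale1 ev_scaleDr ev_scaleDl.

End EvObj.

Program Definition ev_map (F G : ModRAb) (s : hom F G) :
    {linear ev_obj F -> ev_obj G} :=
  @linear_of R (ev_obj F) (ev_obj G) (fun x => s RR x) _.
Next Obligation.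
by move=> r x y; rewrite raddfD; congr (_ + _); apply: (ntE s).
Qed.

Program Definition ev : functor ModRAb (Mod R) :=
  @Functor ModRAb (Mod R) (fun F => ev_obj F : lmodType R) ev_map _ _ _.
Next Obligation. exact: linear_eq. Qed.
Next Obligation. exact: linear_eq. Qed.
Next Obligation. exact: linear_eq. Qed.

(* The objects of mod-R form a set up to isomorphism. *)
Definition fp_index : Type :=
  {mn : nat * nat & {linear 'rV[R^c]_mn.1 -> 'rV[R^c]_mn.2}}.

Lemma fp_rep_ex (k : fp_index) : exists M : modR,
  (exists N : modR, presented (sval N) (projT2 k)) ->
  presented (sval M) (projT2 k).
Proof.
have [[N hN]|no] := pselect (exists N : modR, presented (sval N) (projT2 k)).
  by exists N.
by exists RR.
Qed.

Definition fp_rep (k : fp_index) : modR := sval (cid (fp_rep_ex k)).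

Lemma presented_map (S : pzRingType) (M N : lmodType S) m n
    (a : {linear 'rV[S]_m -> 'rV[S]_n}) (p : {linear 'rV[S]_n -> M})
    (q : {linear 'rV[S]_n -> N}) :
  (forall x, exists v, p v = x) -> (forall v, p v = 0 -> q v = 0) ->
  exists h : {linear M -> N}, forall v, h (p v) = q v.
Proof.
move=> ps pq; pose h x := q (sval (cid (ps x))).
have hE v : h (p v) = q v.
  rewrite /h; case: cid => w /= wv; apply/eqP; rewrite -subr_eq0 -raddfB.
  by apply/eqP/pq; rewrite raddfB /= wv subrr.
have hl : linear h.
  move=> r x y; have [v <-] := ps x; have [w <-] := ps y.
  by rewrite -linearP !hE linearP.
by exists (linear_of hl).
Qed.

Lemma fp_repP (M : modR) : exists k (h : hom M (fp_rep k)) (h' : hom (fp_rep k) M),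
  h' \oc h = idm M.
Proof.
have [m [n [a [p [ps pk]]]]] := svalP M; exists (existT _ (m, n) a).
have [|q [qs qk]] := svalP (cid (fp_rep_ex (existT _ (m, n) a))).
  by exists M, p.
have [v /pk/qk//|h hE] := presented_map a (q := q) ps.
have [v /qk/pk//|h' hE'] := presented_map a (q := p) qs.
exists h, h'; apply: linear_eq => x; have [v <-] := ps x.
by transitivity (h' (h (p v))) => //; rewrite hE hE'.
Qed.

Definition homR (X : modR) : functor modR Ab :=
  compf (homf (sval X)) (@incl (Mod R^c) (@fp_module R^c)).

Section MonoFun.
Variables (F G : ModRAb) (s : hom F G).

Definition nt_inj : Prop := forall (X : modR) x, s X x = 0 -> x = 0.

Lemma nt_inj_epi_op : nt_inj -> epi (s : @hom (op ModRAb) G F).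
Proof.
move=> s0 H g h gh; apply: nt_eq => X; apply: additive_eq => x.
apply/eqP; rewrite -subr_eq0; apply/eqP/(s0 X); rewrite raddfB.
apply/eqP; rewrite subr_eq0; apply/eqP.
by have := congr1 (fun t : nat_trans H G => t X x) gh.
Qed.

Program Definition yoneda_map (X : modR) (x : (F : functor modR Ab) X)
    (A : modR) : {additive homR X A -> (F : functor modR Ab) A} :=
  @additive_of (homR X A) ((F : functor modR Ab) A)
    (fun g => fmap F (g : hom X A) x) _.
Next Obligation.
move=> g h; apply/eqP; rewrite -subr_eq opprK -ab_fmapD.
by apply/eqP; congr (fmap F _ x); apply: subrK.
Qed.

Lemma yoneda_natural (X : modR) (x : (F : functor modR Ab) X) (A B : modR)
  (f : hom A B) : @compm Ab _ _ _ (yoneda_map x B) (fmap (homR X) f) =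
                  @compm Ab _ _ _ (fmap F f) (yoneda_map x A).
Proof.
by apply: additive_eq => g; exact: (ab_fmapM (F := F) f (g : hom X A) x).
Qed.

Definition yoneda_nt (X : modR) (x : (F : functor modR Ab) X) :
    nat_trans (homR X) F :=
  @NatTrans _ Ab (homR X) F (yoneda_map x) (yoneda_natural x).

Lemma epi_op_nt_inj : epi (s : @hom (op ModRAb) G F) -> nt_inj.
Proof.
move=> es X x sx; have := es (homR X) (yoneda_nt x) zerom.
have -> : @compm (op ModRAb) _ _ _ (yoneda_nt x) s =
          @compm (op ModRAb) G F (homR X) zerom s.
  apply: nt_eq => A; apply: additive_eq => g.
  transitivity (s A (fmap F (g : hom X A) x)) => //.
  rewrite ntE sx raddf0; symmetry.
  by transitivity (s A 0) => //; rewrite raddf0.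
move=> /(_ erefl)/(congr1 (fun t : nat_trans (homR X) F => t X (linear_id (sval X)))).
by move=> /= e; rewrite -[LHS](ab_fmap1 (F := F)).
Qed.

End MonoFun.

Section InjectiveHull.
Variable G : ModRAb.

Definition inj_index : Type :=
  {k : fp_index & {additive (G : functor modR Ab) (fp_rep k) -> QZ}}.

(* prod_k Hom_Z(Hom(X, M_k), Q/Z), with G(M_k) -> Q/Z as an extra index *)
Definition inj_obj (X : modR) : Type :=
  forall i : inj_index, {additive {linear sval X -> sval (fp_rep (projT1 i))} -> QZ}.

Section InjObj.
Variable X : modR.
Implicit Types f g : inj_obj X.
HB.instance Definition _ := gen_eqMixin (inj_obj X).
HB.instance Definition _ := gen_choiceMixin (inj_obj X).
Let add f g : inj_obj X := fun i => f i + g i.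
Let opp f : inj_obj X := fun i => - f i.
Let zero : inj_obj X := fun i => 0.
Lemma inj_eq f g : (forall i, f i = g i) -> f = g.
Proof. exact: functional_extensionality_dep. Qed.
Let addA : associative add.
Proof. by move=> f g h; apply: inj_eq => i; apply: addrA. Qed.
Let addC : commutative add.
Proof. by move=> f g; apply: inj_eq => i; apply: addrC. Qed.
Let add0 : left_id zero add.
Proof. by move=> f; apply: inj_eq => i; apply: add0r. Qed.
Let addN : left_inverse zero opp add.
Proof. by move=> f; apply: inj_eq => i; apply: addNr. Qed.
HB.instance Definition _ := GRing.isZmodule.Build (inj_obj X) addA addC add0 addN.
End InjObj.

Program Definition inj_map (X Y : modR) (u : hom X Y) :
    {additive inj_obj X -> inj_obj Y} :=
  @additive_of (inj_obj X) (inj_obj Y)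
    (fun f i => additive_comp (f i) (homf_pre_map _ (u : {linear _ -> _}))) _.
Next Obligation.
by move=> f g; apply: inj_eq => i; apply: additive_eq.
Qed.

Program Definition inj_fun : functor modR Ab :=
  @Functor modR Ab (fun X => inj_obj X : zmodType) inj_map _ _ _.
Next Obligation.
apply: additive_eq => t; apply: inj_eq => i; apply: additive_eq => z.
by congr (t i _); apply: linear_eq.
Qed.
Next Obligation.
apply: additive_eq => t; apply: inj_eq => i.
by apply: additive_eq => z; congr (t i _); apply: linear_eq.
Qed.
Next Obligation.
apply: additive_eq => t; apply: inj_eq => i.
apply: additive_eq => z; rewrite [RHS]additiveDE /=.
rewrite -raddfD; congr (t i _); apply: linear_eq => x /=; exact: raddfD.
Qed.

Section Coinduced.
Variables (H : ModRAb) (X : modR)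
  (psi : forall i : inj_index, {additive (H : functor modR Ab) (fp_rep (projT1 i)) -> QZ}).

Definition coind_ev (y : (H : functor modR Ab) X) (i : inj_index)
  (h : {linear sval X -> sval (fp_rep (projT1 i))}) : QZ :=
  psi i (fmap H (h : hom X (fp_rep (projT1 i))) y).

Lemma coind_evB y i : zmod_morphism (@coind_ev y i).
Proof.
move=> g h; apply/eqP; rewrite -subr_eq opprK /coind_ev -raddfD -ab_fmapD.
by apply/eqP; congr (psi i (fmap H _ y)); apply: subrK.
Qed.

Definition coind_fun (y : (H : functor modR Ab) X) : inj_obj X :=
  fun i => additive_of (@coind_evB y i).

Lemma coind_funB : zmod_morphism coind_fun.
Proof.
move=> x y; apply: inj_eq => i; apply: additive_eq => h.
by rewrite /= /coind_ev !raddfB.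
Qed.

Definition coind_map : {additive (H : functor modR Ab) X -> inj_obj X} :=
  additive_of coind_funB.
End Coinduced.

Section CoinducedNat.
Variables (H : ModRAb)
  (psi : forall i : inj_index, {additive (H : functor modR Ab) (fp_rep (projT1 i)) -> QZ}).

Lemma coind_natural (A B : modR) (f : hom A B) :
  @compm Ab _ _ _ (@coind_map H B psi) (fmap H f) =
  @compm Ab _ _ _ (fmap inj_fun f) (@coind_map H A psi).
Proof.
apply: additive_eq => y; apply: inj_eq => i; apply: additive_eq => h.
congr (psi i _); symmetry.
exact: (ab_fmapM (F := H) (h : hom B (fp_rep (projT1 i))) f y).
Qed.

Definition coind : nat_trans H inj_fun :=
  @NatTrans _ Ab H inj_fun (fun A => @coind_map H A psi) coind_natural.

End CoinducedNat.

Lemma inj_fun_projective : @projective (op ModRAb) inj_fun.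
Proof.
move=> H F e epie f; have e0 := epi_op_nt_inj epie.
have nP i : zmod_morphism (fun x : (F : functor modR Ab) (fp_rep (projT1 i)) =>
    (f (fp_rep (projT1 i)) x : inj_obj _) i (linear_id _)).
  by move=> x y; rewrite raddfB.
have nE (X : modR) x i (h : hom X (fp_rep (projT1 i))) :
    (f X x : inj_obj X) i h = additive_of (nP i) (fmap F h x).
  rewrite /= (ntE f h); congr ((f X x : inj_obj X) i _).
  exact: linear_eq.
have ex i := QZ_injective (additive_of (nP i)) (@e0 (fp_rep (projT1 i))).
exists (coind (fun i => sval (cid (ex i)))).
apply: nt_eq => X; apply: additive_eq => x; apply: inj_eq => i.
apply: additive_eq => h; rewrite nE.
transitivity (sval (cid (ex i)) (fmap H (h : hom X (fp_rep (projT1 i))) (e X x))) => //.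
by case: cid => psi /= psiE; rewrite -(ntE e) psiE.
Qed.

Definition inj_emb : nat_trans G inj_fun := coind (fun i : inj_index => projT2 i).

Lemma inj_emb_inj : nt_inj (inj_emb : @hom ModRAb G inj_fun).
Proof.
move=> X x x0; apply/eqP; apply: contraT => xn0.
have [k [h [h' h'h]]] := fp_repP X.
have hx : fmap G h x != 0.
  apply: contra xn0 => /eqP hx0.
  by rewrite -[x](ab_fmap1 (F := G)) -h'h ab_fmapM hx0 raddf0.
have [g gP] := QZ_cogen hx.
have := congr1 (fun t : inj_obj X => t (existT _ k g) h) x0.
by move=> /= g0; move: gP; rewrite -[X in X != _]/(g _) [g _]g0 eqxx.
Qed.

End InjectiveHull.

Definition ModRAb_presentation (G : op ModRAb) : presentation G.
Proof.
pose I0 := inj_fun G; pose i0 : nat_trans G I0 := inj_emb G.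
pose Q := fcoker i0; pose q : nat_trans I0 Q := fcokerq i0.
pose i1 : nat_trans Q (inj_fun Q) := inj_emb Q.
apply: (@Presentation (op ModRAb) G (inj_fun Q) I0 (nt_comp i1 q) i0).
- exact: inj_fun_projective.
- exact: inj_fun_projective.
- exists Q, q, i1; split=> //; last exact: nt_inj_epi_op (@inj_emb_inj Q).
  exact: fcokerP.
- exact: nt_inj_epi_op (@inj_emb_inj G).
Defined.

Definition D_L : functor (op ModRAb) (fpModAb R) :=
  L0 ModRAb_presentation (@fp_cokernel R) (compf (Yoneda R) (opf ev)).

End ModR.

(* Main.v *)
From mathcomp Require Import all_boot all_order all_algebra.
From mathcomp Require Import boolp.
Require Import Defs.

(** Write I0(G) -> I1(G) for the chosen injective copresentation of G, so that
    G is the kernel of I0(G) -> I1(G), and Yev for the functor I |-> (I(R), -).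
    Then D_L G is the cokernel of Yev I1(G) -> Yev I0(G), and D_L is fully
    faithful for the same reason that a category with enough projectives is
    determined by its projectives.  Three facts are used.

    - Yev is fully faithful on the injectives that occur (Yev_full and
      Yev_faithful).  They are products of functors Hom_Z(Hom_R(-, M), Q/Z),
      which are right exact: Hom_R(-, M) turns right exact sequences into left
      exact ones, and Q/Z is injective (inj_fun_right_exact).  A right exact
      functor F on finitely presented modules is the tensor product with
      F(R), so the maps from F to any H are the R-linear maps F(R) -> H(R)
      (ev_full and ev_faithful).  No tensor product is constructed: a map
      F(R) -> H(R) is extended by additivity to the free modules and then by
      right exactness to all finitely presented modules.  With the Yoneda
      lemma this gives the claim on Yev.
    - The functors (X, -) lift through cokernels of fp(R-Mod, Ab)
      (Yoneda_lifts): these are computed pointwise, and maps out of (X, -) are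
      elements at X.
    - G is the kernel of I0(G) -> I1(G) (ModRAb_presentation_coker).

    Given these, a map D_L A -> D_L B lifts to the two terms of the
    presentations, the lifts come from a commutative square between the
    injective copresentations, and that square restricts to a map B -> A of
    kernels; moreover a map B -> A killed by D_L lifts to a map I0(B) -> I0(A)
    that factors through I0(B) -> I1(B) and therefore vanishes on B
    (L0_fully_faithful). *)

Set Implicit Arguments.
Unset Strict Implicit.
Unset Printing Implicit Defensive.

Import GRing.Theory.
Local Open Scope ring_scope.

(** * Full faithfulness of a zeroth left derived functor *)

Lemma inj_surj_bijective (T U : Type) (f : T -> U) :
  injective f -> (forall y, exists x, f x = y) -> bijective f.
Proof.
move=> fi fs; exists (fun y => sval (cid (fs y))) => x; last by case: cid.
by case: cid => x' /= /fi.
Qed.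

Section L0FullyFaithful.
Variables C D : category.
Variable pres : forall A : C, presentation A.
Variable cok : forall (X Y : D) (f : hom X Y), cokernel f.
Variable F : functor C D.

(** What projectivity of Q gives in an abelian category D; asking only this
    avoids proving that D is abelian. *)
Definition lifts_through_cok (Q : D) : Prop :=
  forall (X Y : D) (f : hom X Y),
    (forall g : hom Q (cok f), exists h, cokerq (cok f) \oc h = g) /\
    (forall h : hom Q Y, cokerq (cok f) \oc h = zerom ->
       exists s, h = f \oc s).

Variable P : C -> Prop.
Hypothesis P_pr0 : forall A, P (pr0 (pres A)).
Hypothesis P_pr1 : forall A, P (pr1 (pres A)).
Hypothesis F_inj : forall A B, P A -> P B ->
  injective (fun f : hom A B => fmap F f).
Hypothesis F_full : forall A B, P A -> P B ->
  forall g : hom (F A) (F B), exists f, fmap F f = g.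
Hypothesis F_lift : forall A, P A -> lifts_through_cok (F A).
Hypothesis pres_coker : forall A, is_cokernel (prd (pres A)) (pre (pres A)).

(** The comparison of projective presentations, run backwards: maps between
    the values of L0 are, up to homotopy, maps between the presentations F P1
    -> F P0, hence maps between the presentations P1 -> P0 themselves, and A
    is recovered from its presentation as a cokernel. *)
Lemma L0_fully_faithful : fully_faithful (L0 pres cok F).
Proof.
move=> A B; apply: inj_surj_bijective => [f g fg|u].
  have [a aE ua] := L0_mapP pres cok F f.
  have [b bE ub] := L0_mapP pres cok F g.
  (* Two lifts a, b with the same image under L0 differ by a boundary. *)
  have ab0 : L0_pi pres cok F B \oc fmap F (addm a (oppm b)) = zerom.
    have ab : L0_pi pres cok F B \oc fmap F a = L0_pi pres cok F B \oc fmap F b.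
      by rewrite -ua -ub; congr (_ \oc _).
    by rewrite fmapD compmDr ab -compmDr -fmapD addmC addNm fmap0 compm0.
  have [_ /(_ _ ab0)[s sE]] := F_lift (P_pr0 A) (fmap F (prd (pres B))).
  have [t tE] := F_full (P_pr0 A) (P_pr1 B) s.
  have {sE}tE : addm a (oppm b) = prd (pres B) \oc t.
    by apply: (F_inj (P_pr0 A) (P_pr0 B)); rewrite fmapM tE.
  apply: (pre_epi (pres A)); rewrite -aE -bE; apply: addm_opp0.
  rewrite -compmN -compmDr tE compmA.
  by have [-> _] := pres_coker B; rewrite comp0m.
have [lift0 _] := F_lift (P_pr0 A) (fmap F (prd (pres B))).
have [h hE] := lift0 (u \oc L0_pi pres cok F A).
have [a aE] := F_full (P_pr0 A) (P_pr0 B) h.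
have [_ ker1] := F_lift (P_pr1 A) (fmap F (prd (pres B))).
have [|s sE] := ker1 (fmap F (a \oc prd (pres A))).
  by rewrite fmapM aE compmA hE -compmA L0_pi_d compm0.
have [b bE] := F_full (P_pr1 A) (P_pr1 B) s.
have ab : a \oc prd (pres A) = prd (pres B) \oc b.
  by apply: (F_inj (P_pr1 A) (P_pr0 B)); rewrite [RHS]fmapM bE.
have [_ uA] := pres_coker A; have [eB _] := pres_coker B.
have [|f [fE _]] := uA _ (pre (pres B) \oc a).
  by rewrite -compmA ab compmA eB comp0m.
exists f; apply: (L0_induced_uniq (L0_mapP pres cok F f)); exists a => //.
by rewrite aE -hE.
Qed.

End L0FullyFaithful.

(** * Kernels in categories of additive functors *)

Lemma ab_is_kernel (C : category) (G H K : Fun C Ab) (i : hom G H)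
    (d : hom H K) :
  (forall A x, i A x = 0 -> x = 0) ->
  (forall A y, d A y = 0 <-> exists x, i A x = y) -> is_kernel d i.
Proof.
move=> i0 dE; split.
  by apply: nt_eq => A; apply: additive_eq => x; apply/(dE A); exists x.
move=> E g dg0.
have iI A : injective (i A).
  move=> x y xy; apply/eqP; rewrite -subr_eq0; apply/eqP/(i0 A).
  by rewrite raddfB xy subrr.
have ex A z : exists x, i A x = g A z.
  by apply/(dE A); have := congr1 (fun t : nat_trans E K => t A z) dg0.
pose l A z := sval (cid (ex A z)).
have lE A z : i A (l A z) = g A z by rewrite /l; case: cid.
have lB A : zmod_morphism (l A).
  by move=> x y; apply: (iI A); rewrite raddfB !lE raddfB.
have lN (A B : C) (f : hom A B) :
   @compm Ab _ _ _ (additive_of (lB B)) (fmap (E : functor C Ab) f) =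
   @compm Ab _ _ _ (fmap (G : functor C Ab) f) (additive_of (lB A)).
  apply: additive_eq => z; apply: (iI B).
  transitivity (i B (l B (fmap (E : functor C Ab) f z))) => //.
  transitivity (i B (fmap (G : functor C Ab) f (l A z))) => //.
  by rewrite lE (ntE i) lE (ntE g).
exists (@NatTrans C Ab E G (fun A => additive_of (lB A)) lN); split.
  by apply: nt_eq => A; apply: additive_eq => z; apply: lE.
move=> v vE; apply: nt_eq => A; apply: additive_eq => z; apply: (iI A).
transitivity (g A z); first exact: lE.
by have := congr1 (fun t : nat_trans E H => t A z) vE.
Qed.

(** * Exactness of duality into Q/Z, and free modules *)

Lemma QZ_factor (B A : zmodType) (i : {additive B -> A})
    (f : {additive B -> QZ}) : (forall b, i b = 0 -> f b = 0) ->
  exists g : {additive A -> QZ}, forall b, g (i b) = f b.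
Proof.
move=> if0; have [|g gP] := @QZ_extend A (fun p => exists b, p = (i b, f b)).
  split; first by exists 0; rewrite !raddf0.
  - by move=> _ _ _ _ [b [-> ->]] [b' [-> ->]]; exists (b - b'); rewrite !raddfB.
  - by move=> y [b [/esym/if0 <- ->]].
by exists g => b; apply: gP; exists b.
Qed.

Section Free.
Variable S : pzRingType.

Lemma fp_free n : @fp_module S ('rV[S]_n : lmodType S).
Proof.
exists 0%N, n, 0, (linear_id _); split=> [x|v]; first by exists x.
split=> [/= -> |[w <-]//]; by exists 0.
Qed.

Lemma free_lift n k (X : lmodType S) (p : {linear 'rV[S]_k -> X})
    (q : {linear 'rV[S]_n -> X}) : (forall x, exists v, p v = x) ->
  exists b : {linear 'rV[S]_n -> 'rV[S]_k}, forall v, p (b v) = q v.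
Proof.
move=> ps; pose c j := sval (cid (ps (q (delta_mx 0 j)))).
have cE j : p (c j) = q (delta_mx 0 j) by rewrite /c; case: cid.
pose C : 'M[S]_(n, k) := \matrix_j c j.
exists (mulmxr C) => v; rewrite /= mulmx_sum_row [in RHS](row_sum_delta v).
rewrite !raddf_sum; apply: eq_bigr => j _.
by rewrite rowK [LHS](linearZ_LR p) [RHS](linearZ_LR q) /= cE.
Qed.

End Free.

(** * Right exact functors are determined by their value at the ring *)

Section RightExact.
Variable R : pzRingType.

Definition freeR n : modR R := exist _ ('rV[R^c]_n : lmodType R^c) (@fp_free R^c n).

Program Definition coordR n (j : 'I_n) : {linear 'rV[R^c]_n -> regR R} :=
  @linear_of R^c 'rV[R^c]_n (regR R) (fun v => v 0 j) _.
Next Obligation. by move=> a u v; rewrite !mxE. Qed.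

(** The scalar r of the converse ring acts on a right module as x |-> x r. *)
Program Definition pointR (X : lmodType R^c) (x : X) : {linear regR R -> X} :=
  @linear_of R^c (regR R) X (fun r : R^c => r *: x) _.
Next Obligation. by move=> a r s; rewrite scalerDl scalerA. Qed.

Lemma sum_point_coord n (v : 'rV[R^c]_n) :
  \sum_j pointR (delta_mx 0 j : 'rV[R^c]_n) (coordR j v) = v.
Proof. by rewrite [RHS]row_sum_delta. Qed.

Lemma ab_fmap_sum (F : ModRAb R) (X Y : modR R) n
    (h : 'I_n -> {linear sval X -> sval Y}) (x : (F : functor (modR R) Ab) X) :
  fmap F ((\sum_i h i) : hom X Y) x = \sum_i fmap F (h i : hom X Y) x.
Proof.
apply: (big_morph (fun g : {linear sval X -> sval Y} => fmap F (g : hom X Y) x)).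
  by move=> f g; exact: (ab_fmapD (F := F) (f : hom X Y) g x).
by have /= -> := fmap0 F X Y.
Qed.

Lemma sum_linearE (X Y : lmodType R^c) n (h : 'I_n -> {linear X -> Y}) x :
  (\sum_i h i) x = \sum_i h i x.
Proof. exact: (big_morph (fun g : {linear X -> Y} => g x)). Qed.

(** Right exactness, tested on presentations by free modules of finite rank. *)
Definition right_exact (F : ModRAb R) : Prop :=
  forall (X : modR R) m n (a : hom (freeR m) (freeR n)) (p : hom (freeR n) X),
  (forall x, exists v, p v = x) -> (forall v, p v = 0 <-> exists w, a w = v) ->
  (forall x, exists w, fmap F p w = x) /\
  (forall w, fmap F p w = 0 -> exists z, fmap F a z = w).

(** F(R^n) = F(R)^n, by additivity. *)
Lemma fmap_free_sum (F : ModRAb R) n (w : (F : functor (modR R) Ab) (freeR n)) :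
  w = \sum_j fmap F (pointR (delta_mx 0 j : 'rV[R^c]_n) : hom (RR R) (freeR n))
        (fmap F (coordR j : hom (freeR n) (RR R)) w).
Proof.
rewrite -[LHS](ab_fmap1 (F := F)).
under eq_bigr do rewrite -(ab_fmapM (F := F)).
rewrite -(ab_fmap_sum (X := freeR n) (Y := freeR n)); congr (fmap F _ w).
apply: linear_eq => v; rewrite [RHS]sum_linearE [LHS](_ : _ = v) //.
by rewrite -{1}(sum_point_coord v).
Qed.

(** An endomorphism of the right module R is a left multiplication, so
    R-linearity for the module structure of F(R) is naturality on the full
    subcategory with the single object R. *)
Lemma ev_linear_fmap (F H : ModRAb R) (phi : {linear ev_obj F -> ev_obj H})
    (h : hom (RR R) (RR R)) z :
  phi (fmap F h z) = fmap H h (phi z).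
Proof.
have -> : h = @lmulR R (h (1 : R)).
  apply: linear_eq => x; rewrite -[in LHS](mulr1 (x : R^c)).
  by rewrite [LHS](linearZ_LR (h : {linear regR R -> regR R}) x 1).
exact: (linearZ_LR phi).
Qed.

Section Extension.
Variables F H : ModRAb R.
Variable phi : {additive (F : functor (modR R) Ab) (RR R) ->
                         (H : functor (modR R) Ab) (RR R)}.
Hypothesis phiE : forall (h : hom (RR R) (RR R)) z,
  phi (fmap F h z) = fmap H h (phi z).

(** phi^n : F(R)^n -> H(R)^n *)
Definition free_ext n (w : (F : functor (modR R) Ab) (freeR n)) :
    (H : functor (modR R) Ab) (freeR n) :=
  \sum_j fmap H (pointR (delta_mx 0 j : 'rV[R^c]_n) : hom (RR R) (freeR n))
    (phi (fmap F (coordR j : hom (freeR n) (RR R)) w)).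

Lemma free_extB n : zmod_morphism (@free_ext n).
Proof. by move=> x y; rewrite -sumrB; apply: eq_bigr => j _; rewrite !raddfB. Qed.

Lemma free_ext_RR n (q : hom (freeR n) (RR R)) w :
  fmap H q (free_ext w) = phi (fmap F q w).
Proof.
rewrite [in RHS](fmap_free_sum w) !raddf_sum; apply: eq_bigr => i _.
by rewrite -(ab_fmapM (F := H)) -phiE (ab_fmapM (F := F)).
Qed.

Lemma free_ext_natural n k (b : hom (freeR n) (freeR k)) w :
  free_ext (fmap F b w) = fmap H b (free_ext w).
Proof.
rewrite [RHS]fmap_free_sum [LHS]/free_ext. apply: eq_bigr => j _; congr (fmap H _ _).
by rewrite -!ab_fmapM free_ext_RR.
Qed.

Hypothesis F_rex : right_exact F.

Lemma right_exact_cover (X : modR R) :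
  exists n (q : hom (freeR n) X), forall x, exists w, fmap F q w = x.
Proof.
have [m [n [a [p [ps pk]]]]] := svalP X.
by have [pF _] := F_rex (X := X) (a := a) (p := p) ps pk; exists n, p.
Qed.

(** The value at x may be computed from any map q of a free module to X and
    any preimage of x under F(q): q lifts through a presentation p of X, and
    F(p) determines its argument up to relations, which H(p) kills.  Allowing
    all q, not only presentations, makes additivity and naturality of the
    extension immediate. *)
Lemma ext_ex (X : modR R) (x : (F : functor (modR R) Ab) X) :
  exists y, forall n (q : hom (freeR n) X) w,
    fmap F q w = x -> fmap H q (free_ext w) = y.
Proof.
have [m [n [a [p [ps pk]]]]] := svalP X.
have [/(_ x)[w wE] pF] := F_rex (X := X) (a := a) (p := p) ps pk.
exists (fmap H (p : hom (freeR n) X) (free_ext w)) => k q v vE.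
have [b bE] := free_lift (q : {linear _ -> _}) ps.
have qE : q = (p : hom (freeR n) X) \oc (b : hom (freeR k) (freeR n)).
  by apply: linear_eq => u /=; rewrite bE.
rewrite qE ab_fmapM -free_ext_natural.
have [|z zE] := pF (fmap F (b : hom (freeR k) (freeR n)) v - w).
  by rewrite raddfB -ab_fmapM -qE vE wE subrr.
have pa : (p : hom (freeR n) X) \oc (a : hom (freeR m) (freeR n)) = zerom.
  by apply: linear_eq => u; apply/pk; exists u.
apply/eqP; rewrite -subr_eq0 -raddfB -free_extB -zE free_ext_natural.
by rewrite -ab_fmapM pa fmap0.
Qed.

Definition ext_fun (X : modR R) (x : (F : functor (modR R) Ab) X) :=
  sval (cid (ext_ex x)).

Lemma ext_funE (X : modR R) n (q : hom (freeR n) X) w :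
  ext_fun (fmap F q w) = fmap H q (free_ext w).
Proof. by rewrite /ext_fun; case: cid => y /= /(_ _ _ _ erefl). Qed.

Lemma ext_funB (X : modR R) : zmod_morphism (@ext_fun X).
Proof.
have [n [q qs]] := right_exact_cover X => x y.
have [v <-] := qs x; have [w <-] := qs y.
by rewrite -raddfB !ext_funE free_extB raddfB.
Qed.

Lemma ext_natural (X Y : modR R) (f : hom X Y) :
  @compm Ab _ _ _ (additive_of (@ext_funB Y)) (fmap F f) =
  @compm Ab _ _ _ (fmap H f) (additive_of (@ext_funB X)).
Proof.
apply: additive_eq => x; have [n [q /(_ x)[w <-]]] := right_exact_cover X.
transitivity (ext_fun (fmap F f (fmap F q w))) => //.
transitivity (fmap H f (ext_fun (fmap F q w))) => //.
by rewrite -ab_fmapM !ext_funE ab_fmapM.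
Qed.

Lemma ext_funRR x : ext_fun x = phi x.
Proof.
have [n [q /(_ x)[w <-]]] := right_exact_cover (RR R).
by rewrite ext_funE free_ext_RR.
Qed.

End Extension.

Lemma ev_full (F H : ModRAb R) (phi : {linear ev_obj F -> ev_obj H}) :
  right_exact F -> exists s : hom F H, ev_map s = phi.
Proof.
move=> F_rex.
pose phi' : {additive (F : functor (modR R) Ab) (RR R) ->
  (H : functor (modR R) Ab) (RR R)} := additive_of (raddfB phi).
have phiE := ev_linear_fmap phi : forall h z, phi' (fmap F h z) = _.
exists (NatTrans (ext_natural phiE F_rex)).
by apply: linear_eq => x; apply: (ext_funRR phiE F_rex).
Qed.

Lemma ev_faithful (F H : ModRAb R) (s t : hom F H) :
  right_exact F -> ev_map s = ev_map t -> s = t.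
Proof.
move=> F_rex st; apply: nt_eq => X; apply: additive_eq => x.
have [n [q /(_ x)[w <-]]] := right_exact_cover F_rex X.
rewrite (fmap_free_sum w) !raddf_sum; apply: eq_bigr => j _.
rewrite !ntE; congr (fmap H q (fmap H _ _)).
rewrite -!ntE.
exact: (congr1 (fun u : {linear ev_obj F -> ev_obj H} => u _) st).
Qed.

(** * The injectives of the copresentations are right exact *)

Section InjRightExact.
Variable G : ModRAb R.

Lemma inj_fun_right_exact : right_exact (inj_fun G).
Proof.
move=> X m n a p ps pk; split=> [f|w pw0].
  (* A family of characters of Hom(X, M_i) extends along the embedding of
     Hom(X, M_i) in Hom(R^n, M_i). *)
  have p0 (M : lmodType R^c) (h : {linear sval X -> M}) :
    homf_pre_map M (p : {linear _ -> _}) h = 0 -> h = 0.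
    move=> hp; apply: linear_eq => x; have [v <-] := ps x.
    exact: (congr1 (fun u : {linear _ -> _} => u v) hp).
  pose g i := sval (cid (QZ_injective (f i) (@p0 (sval (fp_rep (projT1 i)))))).
  have gE i h : g i (homf_pre_map _ (p : {linear _ -> _}) h) = f i h.
    by rewrite /g; case: cid.
  by exists g; apply: inj_eq => i; apply: additive_eq => h; apply: gE.
(* The characters in w vanish on the maps that factor through p, that is, on
   the kernel of Hom(R^n, M_i) -> Hom(R^m, M_i). *)
have w0 i h : homf_pre_map (sval (fp_rep (projT1 i))) (a : {linear _ -> _}) h = 0 ->
    w i h = 0.
  move=> ha0; have [v /pk[u <-]|k kE] := presented_map a (q := h) ps.
    exact: (congr1 (fun t : {linear _ -> _} => t u) ha0).
  have -> : h = homf_pre_map _ (p : {linear _ -> _}) k.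
    by apply: linear_eq => v; rewrite -kE.
  exact: (congr1 (fun t : inj_obj G X => t i k) pw0).
pose g i := sval (cid (QZ_factor (w0 i))).
have gE i h : g i (homf_pre_map _ (a : {linear _ -> _}) h) = w i h.
  by rewrite /g; case: cid.
by exists g; apply: inj_eq => i; apply: additive_eq => h; apply: gE.
Qed.

End InjRightExact.

(** * Representable functors and their cokernels *)

Section YonedaLemma.
Variables (X : Mod R) (F : functor (Mod R) Ab).

Lemma yoneda_ex (x : F X) :
  exists t : nat_trans (homf X) F, t X (linear_id X) = x.
Proof.
have tB A : zmod_morphism
    (fun k : {linear (X : lmodType R) -> (A : Mod R)} => fmap F (k : hom X A) x).
  move=> g h; apply/eqP; rewrite -subr_eq opprK -ab_fmapD.
  by apply/eqP; congr (fmap F _ x); apply: subrK.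
have tN A B (f : hom A B) :
    @compm Ab (homf X A) _ _ (additive_of (@tB B)) (fmap (homf X) f) =
    @compm Ab _ _ _ (fmap F f) (additive_of (@tB A)).
  by apply: additive_eq => k; exact: (ab_fmapM (F := F) f (k : hom X A) x).
by exists (NatTrans tN); rewrite /= -[RHS](ab_fmap1 (F := F)).
Qed.

Lemma yoneda_inj (s t : nat_trans (homf X) F) :
  s X (linear_id X) = t X (linear_id X) -> s = t.
Proof.
by move=> st; apply: nt_eq => A; apply: additive_eq => h; rewrite [LHS]homf_ntE [RHS]homf_ntE st.
Qed.

End YonedaLemma.

Lemma Yoneda_lifts (X : Mod R) :
  lifts_through_cok (@fp_cokernel R) (Yoneda R X).
Proof.
move=> F G f; split=> [g|h qh0].
  have [y yE] := fcokerq_surj (s := f : nat_trans (sval F) (sval G))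
    ((g : nat_trans (homf X) (fcoker f)) X (linear_id X)).
  have [h hE] := yoneda_ex y; exists h; apply: yoneda_inj.
  by rewrite -yE -hE.
have /fcokerq_eq0[y yE] : fcokerq (f : nat_trans (sval F) (sval G)) X
    ((h : nat_trans (homf X) (sval G)) X (linear_id X)) = 0.
  exact: (congr1 (fun t : nat_trans (homf X) (fcoker f) => t X (linear_id X)) qh0).
have [s sE] := yoneda_ex y; exists s; apply: yoneda_inj.
by rewrite -yE -sE.
Qed.

(** * The functor I |-> (I(R), -) on right exact functors *)

Definition Yev : functor (op (ModRAb R)) (fpModAb R) :=
  compf (Yoneda R) (opf (ev R)).

Lemma Yev_full (H F : op (ModRAb R)) : right_exact F ->
  forall t : hom (Yev H) (Yev F), exists s : hom H F, fmap Yev s = t.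
Proof.
move=> F_rex t.
pose phi : {linear ev_obj F -> ev_obj H} :=
  (t : nat_trans (homf (ev R H)) (homf (ev R F))) (ev R H) (linear_id _).
have [s sE] := ev_full phi F_rex.
by exists s; apply: yoneda_inj; rewrite -[RHS]/phi -sE; apply: linear_eq.
Qed.

Lemma Yev_faithful (H F : op (ModRAb R)) : right_exact F ->
  injective (fun s : hom H F => fmap Yev s).
Proof.
move=> F_rex s t st; apply: (ev_faithful F_rex); apply: linear_eq => x.
exact: (congr1 (fun u : nat_trans (homf (ev R H)) (homf (ev R F)) =>
  u (ev R H) (linear_id _) x) st).
Qed.

(** In the opposite category a cokernel is a kernel of functors; since
    I0(G)/G embeds in I1(G), the kernel of I0(G) -> I1(G) is G. *)
Lemma ModRAb_presentation_coker (G : op (ModRAb R)) :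
  is_cokernel (prd (ModRAb_presentation G)) (pre (ModRAb_presentation G)).
Proof.
apply: (@ab_is_kernel _ G (inj_fun G) (inj_fun (fcoker (inj_emb G)))).
  exact: inj_emb_inj.
move=> X y; split=> [/inj_emb_inj/fcokerq_eq0//|/fcokerq_eq0 y0].
by rewrite [LHS](_ : _ = inj_emb _ X (fcokerq (inj_emb G) X y)) // y0 raddf0.
Qed.

End RightExact.

(** * Full faithfulness of D_L *)

Theorem lemma4p2 (R : pzRingType) : fully_faithful (D_L R).
Proof.
apply: (@L0_fully_faithful (op (ModRAb R)) (fpModAb R) _ (@fp_cokernel R)
  (Yev R) (@right_exact R)).
- by move=> G; apply: inj_fun_right_exact.
- by move=> G; apply: inj_fun_right_exact.
- by move=> H F _; apply: Yev_faithful.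
- by move=> H F _; apply: Yev_full.
- by move=> F _; apply: Yoneda_lifts.
- exact: ModRAb_presentation_coker.
Qed.
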